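(* For every real $\alpha$ with $0<\alpha<1/2$ there exist positive constants $a(\alpha)$ and $b(\alpha)$ such that \[ N^{1-2\alpha}(\log N)^{a(\alpha)} \le \Gamma_\alpha(N) \le N^{1-2\alpha}(\log N)^{b(\alpha)} \] for all sufficiently large positive integers $N$.
   Context: For $0<\alpha<1/2$ and a positive integer $N$, define \[ \Gamma_\alpha(N):=\max_{|\mathcal{M}|=N}\frac{1}{N}\sum_{m,n\in\mathcal{M}}\frac{(m,n)^{2\alpha}}{(mn)^{\alpha}}, \] where the maximum is over all finite sets $\mathcal{M}$ of positive integers with exactly $N$ elements, and $(m,n)$ denotes the greatest common divisor of $m$ and $n$. *)

(* Defs.v *)
From HB Require Import structures.
From mathcomp Require Import all_boot all_order all_algebra.
From mathcomp Require Import all_classical all_reals all_analysis.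
Set Implicit Arguments. Unset Strict Implicit. Unset Printing Implicit Defensive.
Import Order.TTheory GRing.Theory Num.Theory.
Local Open Scope ring_scope.
Local Open Scope classical_set_scope.

(* Finite sets of positive integers are represented by duplicate-free lists
   of positive naturals. *)
Definition gcd_sum {R : realType} (alpha : R) (M : seq nat) : R :=
  \sum_(m <- M) \sum_(n <- M)
     ((gcdn m n)%:R `^ (2 * alpha)) / (((m * n)%N)%:R `^ alpha).

Definition Gamma_values {R : realType} (alpha : R) (N : nat) : set R :=
  [set x | exists M : seq nat,
     [/\ uniq M, all (fun m => 0 < m)%N M, size M = N &
         x = N%:R^-1 * gcd_sum alpha M]].

(* Gamma_alpha(N): the maximum (taken as supremum; the set is bounded by N). *)
Definition Gamma {R : realType} (alpha : R) (N : nat) : R :=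
  sup (Gamma_values alpha N).

(* Main.v *)
(* Upper bound.  At most N primes P suffice to tell the N elements of M apart by
   their valuations, and dropping all other primes only increases the summand,
   which becomes the product over p in P of p^(-alpha |v_p(m) - v_p(n)|).  Each
   prime of P contributes a factor 1 + O(1/p) through the inequality
     sum_(i,j) p^(-alpha |i-j|) (u_i v_j)^(1-alpha)
       <= (1 + C/p) (sum_i u_i)^(1-alpha) (sum_j v_j)^(1-alpha),
   which tensorizes over P.  The sum of 1/p over P is at most 2 log log N + O(1)
   by Chebyshev's argument with central binomial coefficients, so the product
   of the factors is a power of log N.

   Lower bound.  Take for M (up to the common factor K!) N fractions a/b in
   lowest terms with ab <= K.  Each summand is then at least K^(-2 alpha), and
   since there are at least (K log K)/8 such fractions, K may be chosen of order
   N / log N. *)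
Require Import Defs.
From HB Require Import structures.
From mathcomp Require Import all_boot all_order all_algebra.
From mathcomp Require Import all_classical all_reals all_analysis.
From mathcomp Require Import ring lra zify.
Import Order.TTheory GRing.Theory Num.Theory.
Local Open Scope ring_scope.
Set Implicit Arguments.
Unset Strict Implicit.
Unset Printing Implicit Defensive.

(** * The inequality at a single prime *)

Definition dist (i j : nat) : nat := (i - j + (j - i))%N.

Lemma distC i j : dist i j = dist j i.
Proof. by rewrite /dist addnC. Qed.

Section LocalInequality.
Variable R : realType.
Implicit Types (x y q r alpha : R).

(** Young's inequality for the conjugate exponents [alpha^-1] and [(1 - alpha)^-1]. *)
Lemma powR_weighted_amgm x y alpha : 0 <= x -> 0 <= y -> 0 < alpha < 1 ->
  x `^ alpha * y `^ (1 - alpha) <= alpha * x + (1 - alpha) * y.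
Proof.
move=> x0 y0 /andP[a0 a1].
have b0 : 0 < 1 - alpha by lra.
have := @conjugate_powR R (x `^ alpha) (y `^ (1 - alpha)) alpha^-1 (1 - alpha)^-1.
rewrite !powR_ge0 !invr_gt0 a0 b0 !invrK -!powRrM !divff ?gt_eqF// !powRr1//.
by rewrite [x * _]mulrC [y * _]mulrC; apply => //; lra.
Qed.

(** The indices on either side of [i] each contribute at most r + r^2 + ... = r / (1 - r). *)
Lemma sum_geometric_dist_le (L : nat) (i : 'I_L) r : 0 <= r -> r < 1 ->
  \sum_(j < L | j != i) r ^+ dist i j <= 2 * r / (1 - r).
Proof.
move=> r0 r1; have r1' : 0 < 1 - r by lra.
have below (n : nat) : \sum_(0 <= j < n) r ^+ (n - j) <= r / (1 - r).
  elim: n => [|n IH]; first by rewrite big_geq// divr_ge0// ltW.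
  rewrite big_nat_recr//= subSnn expr1.
  under eq_big_nat => j /andP[_ jn] do rewrite subSn ?(ltnW jn)// exprS.
  rewrite -mulr_sumr.
  have -> : r / (1 - r) = r * (r / (1 - r)) + r by field; rewrite gt_eqF.
  by rewrite lerD2r ler_wpM2l.
have above (n : nat) : \sum_(0 <= j < n) r ^+ j.+1 <= r / (1 - r).
  apply: le_trans (below n); rewrite [leRHS]big_nat_rev/= add0n.
  by rewrite le_eqVlt; apply/orP; left; apply/eqP; apply: eq_big_nat => j jn;
    congr (_ ^+ _); lia.
have -> : 2 * r / (1 - r) = r / (1 - r) + r / (1 - r) by field; rewrite gt_eqF.
rewrite -(big_mkord (fun j => j != i) (fun j => r ^+ dist i j)).
rewrite (@big_cat_nat _ _ _ i)//=; last exact: ltnW.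
apply: lerD.
  apply: le_trans (below i); rewrite big_mkcond/= ler_sum_nat// => j ji.
  by rewrite fun_if; case: ifP => _; rewrite ?exprn_ge0// /dist (_ : _ + _ = i - j)%N//; lia.
rewrite big_ltn_cond//= eqxx/=.
apply: le_trans (above (L - i.+1)%N).
rewrite -{1}[i.+1]add0n big_addn big_mkcond/= ler_sum_nat// => j ji.
case: ifP => _; rewrite ?exprn_ge0// /dist (_ : _ + _ = j.+1)%N//; lia.
Qed.

(* With [w = (u + v) / 2] and [o] an index maximising [w], the defect
   [delta = 1 - w o] makes the diagonal at most [1 - (1 - 2 alpha) delta],
   while weighted AM-GM bounds the off-diagonal part by a small multiple of
   [delta] plus [O(q)]. *)
Lemma local_inequality_normalized alpha : 0 < alpha -> alpha < 1 / 2 ->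
  exists2 C : R, 0 < C & forall q, 0 < q -> q <= 1 / 2 ->
  forall (L : nat) (u v : 'I_L -> R), (forall i, 0 <= u i) -> (forall i, 0 <= v i) ->
  \sum_i u i = 1 -> \sum_i v i = 1 ->
  \sum_(i < L) \sum_(j < L) (q `^ alpha) ^+ dist i j * (u i * v j) `^ (1 - alpha) <= 1 + C * q.
Proof.
move=> a0 a1; set b := 1 - alpha.
have b0 : 0 < b by rewrite /b; lra.
have h1 : (1 / 2 : R) `^ alpha < 1.
  by rewrite -[ltRHS](congr1 (@^~ alpha) (powR1 R))/= gt0_ltr_powR ?nnegrE//; lra.
have h0 : 0 < (1 / 2 : R) `^ alpha by apply: powR_gt0; lra.
(* For q <= 1/2 and r = q^alpha this gives 2 r / (1 - r) <= c0 r. *)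
set c0 := 2 / (1 - (1 / 2 : R) `^ alpha).
have c00 : 0 < c0 by rewrite divr_gt0//; lra.
(* Chosen so that the multiple of [delta] in the off-diagonal bound, eta (8 + 4 c0), equals the
   diagonal gain 1 - 2 alpha. *)
set eta := (1 - 2 * alpha) / (8 + 4 * c0).
have eta0 : 0 < eta by rewrite divr_gt0//; lra.
(* Makes kappa^alpha eta^b = 1, so that AM-GM for kappa q^k and eta x has r^k x^b on its smaller
   side. *)
set kappa := eta `^ (- (b / alpha)).
have kappa0 : 0 < kappa by exact: powR_gt0.
exists (kappa * (32 + 4 * c0)); first by rewrite mulr_gt0//; lra.
move=> q q0 q1 L u v u0 v0 su sv.
set r := q `^ alpha.
have r0 : 0 < r by exact: powR_gt0.
have rh : r <= (1 / 2) `^ alpha by rewrite ge0_ler_powR ?nnegrE//; lra.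
have r1 : r < 1 by lra.
have amgm (k : nat) x : 0 <= x -> r ^+ k * x `^ b <= kappa * q ^+ k + eta * x.
  move=> x0; have qk0 : 0 <= q ^+ k by rewrite exprn_ge0 ?ltW.
  have X0 : 0 <= kappa * q ^+ k by rewrite mulr_ge0 ?(ltW kappa0).
  have Y0 : 0 <= eta * x by rewrite mulr_ge0 ?(ltW eta0).
  have H := @powR_weighted_amgm _ _ alpha X0 Y0 ltac:(lra).
  have rk : (q ^+ k) `^ alpha = r ^+ k.
    by rewrite -powR_mulrn ?ltW// powRAC powR_mulrn ?powR_ge0.
  have ke : kappa `^ alpha * eta `^ b = 1.
    rewrite -powRrM mulNr divfK ?gt_eqF// -powRD ?addNr ?powRr0//.
    by rewrite (gt_eqF eta0) implybT.
  have e1 : (kappa * q ^+ k) `^ alpha * (eta * x) `^ (1 - alpha) = r ^+ k * x `^ b.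
    rewrite (powRM _ (ltW kappa0) qk0) (powRM _ (ltW eta0) x0) rk -/b -[RHS]mul1r -ke; ring.
  rewrite e1 in H; apply: le_trans H _.
  by apply: lerD; rewrite ler_piMl// /b; lra.
pose w i := (u i + v i) / 2.
have w0 i : 0 <= w i by rewrite /w; have := u0 i; have := v0 i; lra.
have sw : \sum_i w i = 1 by rewrite -mulr_suml big_split/= su sv; lra.
have L0 : (0 < L)%N.
  by case: L u v u0 v0 su sv w w0 sw => // u v _ _ _ _ w _; rewrite big_ord0; lra.
pose o := [arg max_(i > Ordinal L0) w i]%O.
have wo i : w i <= w o by rewrite /o; case: arg_maxP => // j _; apply.
set delta := 1 - w o.
have sw' : \sum_(i | i != o) w i = delta.
  by move: sw; rewrite (bigD1 o)//= /delta => <-; ring.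
have d0 : 0 <= delta by rewrite -sw' sumr_ge0.
have w1 i : w i <= 1 by apply: le_trans (wo i) _; rewrite /delta in d0; lra.
pose z i := w i `^ b.
have z0 i : 0 <= z i by exact: powR_ge0.
have z1 i : z i <= 1.
  by rewrite -[leRHS](congr1 (@^~ b) (powR1 R))/= ge0_ler_powR ?nnegrE// ?ltW.
have zz i : z i * z i = w i * w i `^ (1 - 2 * alpha).
  have nz x : 0 < x -> (x == 0) ==> (w i != 0) by move=> x0; rewrite gt_eqF.
  have -> : w i * w i `^ (1 - 2 * alpha) = w i `^ 1 * w i `^ (1 - 2 * alpha).
    by rewrite powRr1.
  rewrite /z -(powRD (nz (b + b) _)) -?(powRD (nz (1 + (1 - 2 * alpha)) _)); try lra.
  by congr (_ `^ _); rewrite /b; ring.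
have zzw i : z i * z i <= w i.
  rewrite zz ler_piMr//.
  rewrite -[leRHS](congr1 (@^~ (1 - 2 * alpha)) (powR1 R))/=.
  by rewrite ge0_ler_powR ?nnegrE//; lra.
(* Here (u_i v_i)^b <= w_i^(2b) = w_i w_i^(1 - 2 alpha), and AM-GM against 1 bounds w_o^(1 - 2
   alpha) by 1 - (1 - 2 alpha) delta. *)
have diag : \sum_i (u i * v i) `^ b <= 1 - (1 - 2 * alpha) * delta.
  apply: le_trans (_ : \sum_i w i * w o `^ (1 - 2 * alpha) <= _).
    apply: ler_sum => i _; apply: le_trans (_ : z i * z i <= _).
      rewrite /z -powRM// ge0_ler_powR ?nnegrE ?(mulr_ge0 (w0 i)) ?(mulr_ge0 (u0 i)) ?(ltW b0)//.
      by rewrite /w; have := sqr_ge0 (u i - v i); nra.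
    rewrite zz ler_wpM2l// ge0_ler_powR ?nnegrE//; lra.
  rewrite -mulr_suml sw mul1r.
  have := @powR_weighted_amgm (w o) 1 (1 - 2 * alpha) (w0 o) ler01 ltac:(lra).
  by rewrite powR1 /delta; lra.
(* A pair containing [o] is charged to row [o] through z_o <= 1, where a single geometric sum in q
   appears; any other pair is split evenly by AM-GM. *)
pose Q i j := (i == o)%:R * z j + (i != o)%:R * (z i * z i) / 2.
have zQ i j : i != j -> z i * z j <= Q i j + Q j i.
  move=> ij; rewrite /Q.
  have [eio|nio] := eqVneq i o; have [ejo|njo] := eqVneq j o => //=.
  - by rewrite eio ejo eqxx in ij.
  - have := ler_wpM2r (z0 j) (z1 i); have := mulr_ge0 (z0 j) (z0 j); lra.
  - have := ler_wpM2l (z0 i) (z1 j); have := mulr_ge0 (z0 i) (z0 i); lra.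
  - have := sqr_ge0 (z i - z j); rewrite expr2; lra.
set B := eta * delta * (1 + c0 / 2) + kappa * (4 + c0 / 2) * q.
have SQ : \sum_(i < L) \sum_(j < L | j != i) r ^+ dist i j * Q i j <= B.
  rewrite (bigD1 o)//=.
  have e1 : \sum_(j < L | j != o) r ^+ dist o j * Q o j <= kappa * (4 * q) + eta * delta.
    apply: le_trans (_ : \sum_(j < L | j != o) (kappa * q ^+ dist o j + eta * w j) <= _).
      apply: ler_sum => j _; rewrite /Q eqxx/= mul1r mul0r mul0r addr0.
      exact: amgm.
    rewrite big_split/= -!mulr_sumr sw' lerD2r ler_wpM2l ?(ltW kappa0)//.
    apply: le_trans (@sum_geometric_dist_le L o q (ltW q0) ltac:(lra)) _.
    by rewrite ler_pdivrMr; nra.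
  (* Each row sum of powers of r is at most c0 r, and [amgm] with k = 1, x = 1 gives r <= kappa q +
     eta. *)
  have e2 : \sum_(i < L | i != o) \sum_(j < L | j != i) r ^+ dist i j * Q i j
      <= delta * (c0 / 2) * (kappa * q + eta).
    rewrite -sw' -mulrA mulr_suml; apply: ler_sum => i io.
    under eq_bigr => j _ do rewrite /Q (negbTE io) mul0r add0r mul1r.
    rewrite -mulr_suml.
    have gs := @sum_geometric_dist_le L i r (ltW r0) r1.
    have g2 : 2 * r / (1 - r) <= c0 * r.
      rewrite ler_pdivrMr; last lra.
      have -> : 2 * r = c0 * r * (1 - (1 / 2) `^ alpha).
        by rewrite /c0; field; rewrite gt_eqF//; lra.
      by rewrite (ler_wpM2l (mulr_ge0 (ltW c00) (ltW r0)))//; lra.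
    have rk : r <= kappa * q + eta.
      by have := amgm 1%N 1 ler01; rewrite powR1 !expr1 !mulr1.
    have cr : c0 * r <= c0 * (kappa * q + eta) by rewrite ler_wpM2l// ltW.
    have S0 : 0 <= \sum_(j < L | j != i) r ^+ dist i j.
      by rewrite sumr_ge0// => j _; rewrite exprn_ge0 ?ltW.
    have := ler_pM S0 (mulr_ge0 (z0 i) (z0 i)) (le_trans gs (le_trans g2 cr)) (zzw i).
    lra.
  apply: le_trans (lerD e1 e2) _.
  have d1 : delta <= 1 by rewrite /delta; have := w0 o; lra.
  have ck : 0 <= c0 / 2 * (kappa * q).
    exact: mulr_ge0 (divr_ge0 (ltW c00) (ler0n _ _)) (mulr_ge0 (ltW kappa0) (ltW q0)).
  have := ler_wpM2r ck d1; rewrite /B; lra.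
have SQ' : \sum_(i < L) \sum_(j < L | j != i) r ^+ dist i j * Q j i <= B.
  apply: le_trans SQ; rewrite (exchange_big_dep predT)//= le_eqVlt; apply/orP; left.
  apply/eqP; apply: eq_bigr => i _; apply: eq_big => [j|j _]; first by rewrite eq_sym.
  by rewrite distC.
(* Uses u_i v_j <= (u_i + v_i) (u_j + v_j) = 4 w_i w_j and 4^b <= 4. *)
have off : \sum_(i < L) \sum_(j < L | j != i) r ^+ dist i j * (u i * v j) `^ b <= 4 * (B + B).
  apply: le_trans (ler_wpM2l _ (lerD SQ SQ')) => //.
  rewrite -big_split/= mulr_sumr; apply: ler_sum => i _.
  rewrite -big_split/= mulr_sumr; apply: ler_sum => j ji.
  rewrite -mulrDr mulrCA ler_wpM2l ?exprn_ge0 ?(ltW r0)//.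
  apply: le_trans (_ : 4 * (z i * z j) <= _); last first.
    by rewrite ler_wpM2l// zQ// eq_sym.
  apply: le_trans (_ : (4 * (w i * w j)) `^ b <= _).
    rewrite ge0_ler_powR ?nnegrE ?(mulr_ge0 (u0 i)) ?(mulr_ge0 (ler0n _ 4) (mulr_ge0 (w0 i) (w0 j))) ?(ltW b0)//.
    have -> : 4 * (w i * w j) = (u i + v i) * (u j + v j) by rewrite /w; field.
    by apply: ler_pM => //; have := v0 i; have := u0 j; lra.
  rewrite (powRM _ (ler0n _ 4) (mulr_ge0 (w0 i) (w0 j))) (powRM _ (w0 i) (w0 j)).
  by apply: ler_wpM2r (mulr_ge0 (z0 i) (z0 j)) _ _ _; apply: ler1_powR; rewrite /b; lra.
rewrite (_ : \sum_i _ = \sum_i (u i * v i) `^ b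
    + \sum_(i < L) \sum_(j < L | j != i) r ^+ dist i j * (u i * v j) `^ b); last first.
  rewrite -big_split/=; apply: eq_bigr => i _.
  by rewrite (bigD1 i)//= /dist subnn expr0 mul1r.
apply: le_trans (lerD diag off) _.
have -> : 4 * (B + B) = (1 - 2 * alpha) * delta + kappa * (32 + 4 * c0) * q.
  by rewrite /B /eta; field; rewrite gt_eqF//; lra.
lra.
Qed.

(** Both sides are homogeneous of degree [1 - alpha] in [u] and in [v], which reduces to sums equal
    to 1; if a sum is zero, every term on the left vanishes. *)
Lemma local_inequality alpha : 0 < alpha -> alpha < 1 / 2 ->
  exists2 C : R, 0 < C & forall q, 0 < q -> q <= 1 / 2 ->
  forall (L : nat) (u v : 'I_L -> R), (forall i, 0 <= u i) -> (forall i, 0 <= v i) ->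
  \sum_(i < L) \sum_(j < L) (q `^ alpha) ^+ dist i j * (u i * v j) `^ (1 - alpha)
    <= (1 + C * q) * ((\sum_i u i) * (\sum_i v i)) `^ (1 - alpha).
Proof.
move=> a0 a1; have [C C0 HC] := local_inequality_normalized a0 a1.
exists C => // q q0 q1 L u v u0 v0.
have b0 : 1 - alpha != 0 by rewrite gt_eqF//; lra.
have RHS0 : 0 <= (1 + C * q) * ((\sum_i u i) * (\sum_i v i)) `^ (1 - alpha).
  by rewrite mulr_ge0 ?powR_ge0// addr_ge0// mulr_ge0 ?ltW.
have su0 : 0 <= \sum_i u i by rewrite sumr_ge0.
have sv0 : 0 <= \sum_i v i by rewrite sumr_ge0.
have [/eqP|su] := eqVneq (\sum_i u i) 0.
  rewrite psumr_eq0// => /allP u00; rewrite big1// => i _; rewrite big1// => j _.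
  by have /eqP -> := u00 i (mem_index_enum i); rewrite mul0r powR0// mulr0.
have [/eqP|sv] := eqVneq (\sum_i v i) 0.
  rewrite psumr_eq0// => /allP v00; rewrite big1// => i _; rewrite big1// => j _.
  by have /eqP -> := v00 j (mem_index_enum j); rewrite mulr0 powR0// mulr0.
set U := \sum_i u i in su su0 RHS0 *; set V := \sum_i v i in sv sv0 RHS0 *.
have := HC q q0 q1 L (fun i => u i / U) (fun i => v i / V).
rewrite -!mulr_suml !divff// => H.
have {}H := H (fun i => divr_ge0 (u0 i) su0) (fun i => divr_ge0 (v0 i) sv0) erefl erefl.
have := ler_wpM2r (powR_ge0 (U * V) (1 - alpha)) H.
apply: le_trans; rewrite le_eqVlt; apply/orP; left; apply/eqP.
rewrite mulr_suml; apply: eq_bigr => i _; rewrite mulr_suml; apply: eq_bigr => j _.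
rewrite -[RHS]mulrA; congr (_ * _).
have uv0 := mulr_ge0 (divr_ge0 (u0 i) su0) (divr_ge0 (v0 j) sv0).
rewrite -(powRM _ uv0 (mulr_ge0 su0 sv0)); congr (_ `^ _); field.
by rewrite su sv.
Qed.

End LocalInequality.

(** * Few primes separate the elements of a finite set *)

Definition separated (P M : seq nat) : Prop :=
  {in M &, forall m n, (forall p, p \in P -> logn p m = logn p n) -> m = n}.

(** Induction on [M]: since [P] already separates [M], at most one [y] in [M] agrees with the new
    [x] on [P], and one further prime tells [x] from [y]. *)
Lemma exists_separating_primes (M : seq nat) :
  uniq M -> all (fun m => 0 < m)%N M ->
  exists P : seq nat,
    [/\ uniq P, all prime P, (size P <= size M)%N & separated P M].
Proof.
elim: M => [|x M IH] /=; first by exists [::]; split.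
case/andP=> xM uM /andP[x0 M0]; have [P [uP pP sP sepP]] := IH uM M0.
have [[y yM xy]|nxy] := pselect (exists2 y, y \in M &
    forall p, p \in P -> logn p x = logn p y); last first.
  exists P; split=> //; first exact: leqW.
  move=> m n; rewrite !inE => /predU1P[->|mM] /predU1P[->|nM]// H.
  - by exfalso; apply: nxy; exists n.
  - by exfalso; apply: nxy; exists m => // p pP'; rewrite H.
  - exact: sepP.
have y0 : (0 < y)%N by exact: (allP M0).
have [q qxy] : exists q, logn q x != logn q y.
  apply: contrapT => /forallNP H; move: xM; rewrite (_ : x = y) ?yM//.
  by apply: eqn_from_log => // q; apply/eqP; apply/negPn/negP; exact: H.
(* [logn] is 0 at a non-prime base, so a base where the two values differ is prime. *)
have pq : prime q.
  have logn0 z : ~~ prime q -> logn q z = 0%N by move=> npq; rewrite lognE (negbTE npq).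
  by apply: contraNT qxy => npq; rewrite !logn0.
have qP : q \notin P by apply: contra qxy => /xy ->.
exists (q :: P); split => //=; [by rewrite qP | by rewrite pq|].
have xz z : z \in M -> (forall p, p \in q :: P -> logn p x = logn p z) -> x = z.
  move=> zM H; have yz : y = z.
    by apply: sepP => // p pP'; rewrite -xy// H// inE pP' orbT.
  by move: qxy; rewrite yz H ?mem_head// eqxx.
move=> m n; rewrite !inE => /predU1P[->|mM] /predU1P[->|nM]// H.
- exact: xz.
- by apply/esym; apply: xz => // p pP'; rewrite H.
- by apply: sepP => // p pP'; apply: H; rewrite inE pP' orbT.
Qed.

(** Powers of distinct primes are coprime. Applied below to mn / (m,n)^2 and to central binomial
    coefficients. *)
Lemma prod_prime_powers_dvdn (P : seq nat) (e : nat -> nat) (Q : nat) :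
  uniq P -> all prime P -> (forall p, p \in P -> p ^ e p %| Q)%N ->
  (\prod_(p <- P) p ^ e p %| Q)%N.
Proof.
elim: P => [|p P IH]/=; first by rewrite big_nil dvd1n.
case/andP=> pP uP /andP[pp aP] H; rewrite big_cons Gauss_dvd.
  by rewrite H ?mem_head// IH// => q qP; apply: H; rewrite inE qP orbT.
apply: coprimeXl; rewrite big_seq.
apply: (big_ind (fun n => coprime p n)) => [|a b ca cb|q qP]; first exact: coprimen1.
  by rewrite coprimeMr ca.
apply: coprimeXr; rewrite prime_coprime// dvdn_prime2// ?(allP aP)//.
by apply: contra pP => /eqP ->.
Qed.

(** * Tensorizing the local inequality over the primes *)

Section ValuationKernel.
Variables (R : realType) (alpha : R).
Hypotheses (alpha_gt0 : 0 < alpha) (alpha_lt : alpha < 1 / 2).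

Definition valuation_kernel (P : seq nat) (m n : nat) : R :=
  \prod_(p <- P) (p%:R^-1 `^ alpha) ^+ dist (logn p m) (logn p n).

(** The left side is Q^(-alpha) with Q = mn / (m,n)^2, and v_p(Q) = |v_p(m) - v_p(n)|. The part of Q
    built from [P] divides Q, and a negative power decreases. *)
Lemma gcd_term_le_valuation_kernel (P : seq nat) (m n : nat) :
  uniq P -> all prime P -> (0 < m)%N -> (0 < n)%N ->
  (gcdn m n)%:R `^ (2 * alpha) / (m * n)%:R `^ alpha <= valuation_kernel P m n.
Proof.
move=> uP pP m0 n0; set g := gcdn m n.
have g0 : (0 < g)%N by rewrite gcdn_gt0 m0.
set Q := ((m %/ g) * (n %/ g))%N.
have mg : (m = m %/ g * g)%N by rewrite divnK// dvdn_gcdl.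
have ng : (n = n %/ g * g)%N by rewrite divnK// dvdn_gcdr.
have mg0 : (0 < m %/ g)%N by move: m0; rewrite {1}mg muln_gt0 => /andP[].
have ng0 : (0 < n %/ g)%N by move: n0; rewrite {1}ng muln_gt0 => /andP[].
have Q0 : (0 < Q)%N by rewrite muln_gt0 mg0.
have mnE : (m * n = g ^ 2 * Q)%N by rewrite {1}mg {1}ng /Q expnS expn1; ring.
have gR : (0 : R) < g%:R by rewrite ltr0n.
have -> : g%:R `^ (2 * alpha) / (m * n)%:R `^ alpha = (Q%:R^-1 : R) `^ alpha.
  rewrite mnE natrM natrX powRM ?exprn_ge0 ?ler0n// powRrM powR_mulrn ?ltW//.
  have QV : (Q%:R^-1 : R) `^ alpha = (Q%:R `^ alpha)^-1.
    by rewrite -powR_inv1 ?ler0n// powRAC powR_inv1 ?powR_ge0.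
  rewrite QV invfM mulrA divff ?mul1r// gt_eqF// powR_gt0// exprn_gt0//.
have -> : valuation_kernel P m n =
    ((\prod_(p <- P) p ^ dist (logn p m) (logn p n))%N%:R^-1) `^ alpha.
  rewrite /valuation_kernel; elim: P {uP pP} => [|p P IH].
    by rewrite !big_nil invr1 powR1.
  rewrite !big_cons IH natrM invfM powRM ?invr_ge0 ?ler0n//; congr (_ * _).
  rewrite natrX -exprVn -[in RHS]powR_mulrn ?invr_ge0// powRAC.
  by rewrite powR_mulrn ?powR_ge0.
have pr0 : (0 < \prod_(p <- P) p ^ dist (logn p m) (logn p n))%N.
  rewrite big_seq; apply: (big_ind (fun n => 0 < n)%N) => // [a b a0 b0|p pp].
    by rewrite muln_gt0 a0.
  by rewrite expn_gt0 prime_gt0// (allP pP).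
apply: ge0_ler_powR; rewrite ?nnegrE ?invr_ge0 ?ler0n ?(ltW alpha_gt0)//.
rewrite lef_pV2 ?posrE ?ltr0n// ler_nat dvdn_leq//.
apply: prod_prime_powers_dvdn => // p pp.
have -> : dist (logn p m) (logn p n) = logn p Q.
  rewrite lognM// !logn_div ?dvdn_gcdl ?dvdn_gcdr// logn_gcd// /dist; lia.
exact: pfactor_dvdnn.
Qed.

(* Induction on [P]: splitting [A] and [B] according to the valuation at the
   first prime leaves exactly the one-dimensional inequality. *)
Lemma valuation_kernel_sum_le : exists2 C : R, 0 < C &
  forall P : seq nat, all prime P -> forall A B : seq nat,
  uniq A -> uniq B -> separated P A -> separated P B ->
  \sum_(m <- A) \sum_(n <- B) valuation_kernel P m n
    <= \prod_(p <- P) (1 + C / p%:R) * ((size A)%:R * (size B)%:R) `^ (1 - alpha).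
Proof.
have [C C0 HC] := local_inequality alpha_gt0 alpha_lt.
exists C => // P; elim: P => [_|p P IH /= /andP[pp pP]] A B uA uB sA sB.
  (* With no primes left, a separated set has at most one element and the kernel is 1; an empty set
     makes the right side 0, as 1 - alpha is nonzero. *)
  have small (M : seq nat) : uniq M -> separated [::] M -> (size M <= 1)%N.
    case: M => [|x [|y M]]//= /andP[xM _] sM; have xy : x = y.
      by apply: sM; rewrite ?inE ?eqxx ?orbT.
    by move: xM; rewrite xy mem_head.
  rewrite big_nil mul1r.
  under eq_bigr => m _ do under eq_bigr => n _ do rewrite /valuation_kernel big_nil.
  under eq_bigr => m _ do rewrite -(natr_sum _ B xpredT (fun=> 1%N)) sum1_size.
  rewrite big_const_seq count_predT iter_addr_0; have := small A uA sA; have := small B uB sB.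
  have a1 : 1 - alpha != 0 by move: alpha_lt => ?; rewrite gt_eqF//; lra.
  case: (size A) (size B) => [|[|//]] [|[|//]] _ _.
  - by rewrite !mul0r ?powR0.
  - by rewrite !mul0r ?powR0.
  - by rewrite !mulr0 ?powR0// mul0rn.
  - by rewrite mulr1 powR1.
pose L := (\max_(m <- A ++ B) logn p m)%N.
(* By the choice of [L], [inord] keeps the valuation of every element of [A ++ B]; on other numbers
   it may return a default. *)
pose h m : 'I_L.+1 := inord (logn p m).
have hE m : m \in A ++ B -> (h m : nat) = logn p m.
  by move=> mAB; rewrite inordK// ltnS (leq_bigmax_seq m).
pose fib (M : seq nat) (i : 'I_L.+1) := [seq m <- M | h m == i].
have fibE (M : seq nat) (F : nat -> R) :
    \sum_(m <- M) F m = \sum_(i < L.+1) \sum_(m <- fib M i) F m.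
  rewrite (partition_big h xpredT)//=; apply: eq_bigr => i _.
  by rewrite big_filter.
have size_fib (M : seq nat) : (size M)%:R = \sum_(i < L.+1) (size (fib M i))%:R :> R.
  have := fibE M (fun=> 1); rewrite -(natr_sum _ M xpredT (fun=> 1%N)) sum1_size => ->.
  by apply: eq_bigr => i _; rewrite -(natr_sum _ _ xpredT (fun=> 1%N)) sum1_size.
(* The valuation at [p] is constant on a fibre, so the primes of [P] alone separate it. *)
have sep_fib (M : seq nat) i : {subset M <= A ++ B} -> separated (p :: P) M ->
    separated P (fib M i).
  move=> MAB sM m n; rewrite !mem_filter => /andP[/eqP hm mM] /andP[/eqP hn nM] H.
  apply: sM => // q; rewrite inE => /predU1P[->|]; last exact: H.
  by rewrite -!hE ?MAB// hm hn.
have AAB : {subset A <= A ++ B} by move=> m mA; rewrite mem_cat mA.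
have BAB : {subset B <= A ++ B} by move=> m mB; rewrite mem_cat mB orbT.
set r := p%:R^-1 `^ alpha.
have -> : \sum_(m <- A) \sum_(n <- B) valuation_kernel (p :: P) m n =
    \sum_(i < L.+1) \sum_(j < L.+1) r ^+ dist i j *
      \sum_(m <- fib A i) \sum_(n <- fib B j) valuation_kernel P m n.
  rewrite fibE; apply: eq_bigr => i _.
  under [LHS]eq_bigr => m _ do rewrite fibE.
  rewrite exchange_big/=; apply: eq_bigr => j _.
  rewrite mulr_sumr [LHS]big_seq [RHS]big_seq; apply: eq_bigr => m.
  rewrite mem_filter => /andP[/eqP hm mA].
  rewrite mulr_sumr [LHS]big_seq [RHS]big_seq; apply: eq_bigr => n.
  rewrite mem_filter => /andP[/eqP hn nB].
  by rewrite /valuation_kernel big_cons -/r -(hE m (AAB m mA)) -(hE n (BAB n nB)) hm hn.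
set CP := \prod_(q <- P) (1 + C / q%:R).
have CP0 : 0 <= CP.
  by rewrite prodr_ge0// => q _; rewrite addr_ge0 ?divr_ge0 ?ler0n// ltW.
have q0 : 0 < (p%:R^-1 : R) by rewrite invr_gt0 ltr0n prime_gt0.
have q1 : p%:R^-1 <= 1 / 2 :> R.
  by rewrite div1r lef_pV2 ?posrE ?ltr0n ?prime_gt0// ler_nat prime_gt1.
have := HC _ q0 q1 L.+1 (fun i => (size (fib A i))%:R) (fun i => (size (fib B i))%:R)
  (fun i => ler0n _ _) (fun i => ler0n _ _).
rewrite -!size_fib -/r => /(ler_wpM2l CP0) H.
rewrite big_cons -/CP [_ * CP]mulrC -[leRHS]mulrA; apply: le_trans H.
rewrite mulr_sumr; apply: ler_sum => i _; rewrite mulr_sumr; apply: ler_sum => j _.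
rewrite [leRHS]mulrCA ler_wpM2l ?exprn_ge0 ?powR_ge0//.
by apply: IH; rewrite ?filter_uniq//; apply: sep_fib.
Qed.

End ValuationKernel.

(** * Chebyshev's bound for primes in dyadic intervals *)

Lemma leq_bin_exp2 n k : ('C(n, k) <= 2 ^ n)%N.
Proof.
elim: n k => [|n IH] [|k]//; first by rewrite bin0 expn_gt0.
by rewrite binS expnS mul2n -addnn leq_add.
Qed.

(** Such a prime divides (2n)! but not n!. *)
Lemma prime_dvdn_central_bin p n : prime p -> (n < p <= n + n)%N -> (p %| 'C(n + n, n))%N.
Proof.
move=> pp /andP[np p2n].
have pn : ~~ (p %| n`!)%N.
  elim: n np {p2n} => [|n IH] np; first by rewrite fact0 dvdn1 gtn_eqF ?prime_gt1.
  by rewrite factS Euclid_dvdM// negb_or IH ?gtnNdvd// ltnW.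
have : (p %| (n + n)`!)%N by rewrite dvdn_fact// prime_gt0.
by rewrite -(@bin_fact (n + n) n) ?leq_addr// addnK !Euclid_dvdM// (negbTE pn) !orbF.
Qed.

(** The product of these primes is at least 2^J to the power of their number and divides a central
    binomial coefficient, which is at most 2^(2^(J+1)); compare exponents of 2. *)
Lemma dyadic_prime_count J :
  (J * size [seq p <- index_iota (2 ^ J).+1 (2 ^ J.+1).+1 | prime p] <= 2 ^ J.+1)%N.
Proof.
set s := [seq p <- _ | _].
have ps p : p \in s -> prime p /\ (2 ^ J < p <= 2 ^ J + 2 ^ J)%N.
  by rewrite mem_filter mem_index_iota expnS mul2n addnn ltnS => /andP[].
have us : uniq s by rewrite filter_uniq ?iota_uniq.
have dvd : (\prod_(p <- s) p ^ 1 %| 'C(2 ^ J + 2 ^ J, 2 ^ J))%N.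
  apply: prod_prime_powers_dvdn => //; first by apply/allP => p /ps[].
  by move=> p /ps[pp H]; rewrite expn1 prime_dvdn_central_bin.
have le1 : ((2 ^ J) ^ size s <= \prod_(p <- s) p ^ 1)%N.
  rewrite -iter_muln_1 -[size s]count_predT -big_const_seq.
  rewrite big_seq [leqRHS]big_seq leq_prod// => p /ps[_ /andP[H _]].
  by rewrite expn1 ltnW.
rewrite -(@leq_exp2l 2)// expnM expnS mul2n -addnn.
apply: leq_trans le1 _; apply: leq_trans (leq_bin_exp2 _ (2 ^ J)).
by rewrite dvdn_leq// bin_gt0 leq_addr.
Qed.

(** * Sums of reciprocals of primes *)

Section PrimeSums.
Variable R : realType.

(** The 1/2 is the prime 2. A block from 2^j to 2^(j+1) holds at most 2^(j+1) / j primes, each with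
    reciprocal at most 2^(-j). *)
Lemma sum_prime_inv_dyadic J :
  \sum_(0 <= p < (2 ^ J.+1).+1 | prime p) (p%:R^-1 : R)
    <= 1 / 2 + \sum_(1 <= j < J.+1) 2 / j%:R.
Proof.
elim: J => [|J IH].
  rewrite expn1 [X in _ <= _ + X]big_geq// addr0 big_mkcond/=.
  by rewrite !big_nat_recl// big_geq//=; lra.
rewrite (@big_cat_nat _ _ _ (2 ^ J.+1).+1)//=; last by rewrite ltnS leq_exp2l.
rewrite [in leRHS]big_nat_recr//= addrA lerD//.
set s := [seq p <- index_iota (2 ^ J.+1).+1 (2 ^ J.+2).+1 | prime p].
rewrite -big_filter -/s.
have J0 : (0 : R) < J.+1%:R by rewrite ltr0n.
have E0 : (0 : R) < (2 ^ J.+1)%N%:R by rewrite ltr0n expn_gt0.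
apply: le_trans (_ : \sum_(p <- s) ((2 ^ J.+1)%N%:R^-1 : R) <= _).
  rewrite big_seq [leRHS]big_seq ler_sum// => p.
  rewrite mem_filter mem_index_iota => /and3P[pp lp _].
  by rewrite lef_pV2 ?posrE// ?ltr0n ?prime_gt0// ler_nat ltnW.
rewrite big_const_seq count_predT iter_addr_0 -[_ *+ size s]mulr_natl ler_pdivrMr// mulrAC ler_pdivlMr//.
by rewrite mulrC -!natrM ler_nat -expnS dyadic_prime_count.
Qed.

(** ln (1 + x) <= x at x = -1/(k+1) gives 1/(k+1) <= ln (k+1) - ln k. *)
Lemma harmonic_le_ln n : (0 < n)%N ->
  \sum_(1 <= j < n.+1) (j%:R^-1 : R) <= 1 + ln n%:R.
Proof.
elim: n => // -[_ _|n IH _]; first by rewrite big_nat1 ln1 invr1; lra.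
rewrite big_nat_recr//=; apply: le_trans (lerD (IH isT) (lexx _)) _.
rewrite -addrA lerD2l; have : (0 < n.+1)%N by []; move: n.+1 => k kn {IH}.
have k0 : (0 : R) < k%:R by rewrite ltr0n.
have k1 : (0 : R) < k.+1%:R by rewrite ltr0n.
have := @le_ln1Dx R (- k.+1%:R^-1).
rewrite ltrN2 invf_lt1// ltr1n => /(_ kn).
have -> : 1 - k.+1%:R^-1 = k%:R / k.+1%:R :> R.
  by rewrite -[k.+1]addn1 natrD; field; rewrite gt_eqF// -natr1; lra.
rewrite ln_div ?posrE//.
move: (k.+1%:R^-1) => t; lra.
Qed.

(** ln (1 + x) <= x at x = 1/k gives ln (k+1) - ln k <= 1/k. *)
Lemma harmonic_ge_ln n : ln n.+1%:R <= \sum_(1 <= j < n.+1) (j%:R^-1 : R).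
Proof.
elim: n => [|n IH]; first by rewrite big_geq// ln1.
rewrite big_nat_recr//=; apply: le_trans _ (lerD IH (lexx _)).
have : (0 < n.+1)%N by []; move: n.+1 => k kn {IH}; have k0 : (0 : R) < k%:R by rewrite ltr0n.
have k1 : (0 : R) < k.+1%:R by rewrite ltr0n.
have := @le_ln1Dx R (k%:R^-1).
have kv : (0 : R) < k%:R^-1 by rewrite invr_gt0.
have -> : 1 + k%:R^-1 = k.+1%:R / k%:R :> R.
  by rewrite -[k.+1]addn1 natrD; field; rewrite gt_eqF.
rewrite ln_div ?posrE// => H; have {}H := H ltac:(lra).
move: (k%:R^-1) H => t; lra.
Qed.

(** The harmonic bound at 2 reads 3/2 <= 1 + ln 2. *)
Lemma ln2_ge_half : 1 / 2 <= ln 2 :> R.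
Proof.
have := @harmonic_le_ln 2 isT; rewrite big_nat_recr//= big_nat1; lra.
Qed.

(** With 2^J <= N < 2^(J+1), ln 2 >= 1/2 gives J <= 2 ln N, hence ln J <= 1 + ln ln N in the dyadic
    bound 1/2 + 2 (1 + ln J). *)
Lemma sum_prime_inv_le N : (0 < N)%N -> 1 <= ln (N%:R : R) ->
  \sum_(0 <= p < N.+1 | prime p) (p%:R^-1 : R) <= 7 + 2 * ln (ln N%:R).
Proof.
move=> N0 lN1; set J := trunc_log 2 N.
have J2 : (2 ^ J <= N)%N by exact: trunc_logP.
have NJ : (N < 2 ^ J.+1)%N by exact: trunc_log_ltn.
have J0 : (0 < J)%N.
  rewrite trunc_log_gt0/=; case: N N0 lN1 {J J2 NJ} => [|[|]]// _.
  by rewrite ln1; lra.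
have JR : J%:R <= 2 * ln (N%:R : R).
  have : ln ((2 ^ J)%N%:R : R) <= ln N%:R.
    by rewrite ler_ln ?posrE ?ltr0n ?expn_gt0// ler_nat.
  rewrite natrX lnXn// -[ln 2 *+ J]mulr_natr.
  have := ler_wpM2r (ler0n R J) ln2_ge_half; move: (ln _) (ln _) => s t; lra.
apply: le_trans (_ : \sum_(0 <= p < (2 ^ J.+1).+1 | prime p) (p%:R^-1 : R) <= _).
  rewrite [leRHS](@big_cat_nat _ _ _ N.+1)//=; last by rewrite ltnS ltnW.
  by rewrite lerDl sumr_ge0.
apply: le_trans (sum_prime_inv_dyadic J) _.
rewrite -mulr_sumr; have := @harmonic_le_ln J J0.
have : ln (J%:R : R) <= 1 + ln (ln N%:R).
  apply: le_trans (_ : ln (2 * ln (N%:R : R)) <= _).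
    by rewrite ler_ln ?posrE ?ltr0n ?mulr_gt0//; lra.
  rewrite lnM ?posrE//; last lra.
  have := @le_ln1Dx R 1; have -> : 1 + 1 = 2 :> R by lra.
  lra.
lra.
Qed.

Lemma ler_sum_uniq_sub (I : eqType) (s t : seq I) (F : I -> R) :
  (forall i, 0 <= F i) -> uniq s -> {subset s <= t} ->
  \sum_(i <- s) F i <= \sum_(i <- t) F i.
Proof.
move=> F0; elim: s t => [|x s IH] t /=; first by rewrite big_nil sumr_ge0.
case/andP=> xs us st; have xt : x \in t by rewrite st ?mem_head.
rewrite (perm_big _ (perm_to_rem xt)) !big_cons lerD2l IH// => y ys.
have : y \in x :: rem x t by rewrite -(perm_mem (perm_to_rem xt)) st// inE ys orbT.
by rewrite inE => /predU1P[yx|//]; rewrite -yx ys in xs.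
Qed.

(** The primes of [P] above N number at most N, so their reciprocals add at most 1 to the sum over
    all primes up to N. *)
Lemma sum_inv_primes_le (P : seq nat) N : uniq P -> all prime P ->
  (size P <= N)%N -> (0 < N)%N -> 1 <= ln (N%:R : R) ->
  \sum_(p <- P) (p%:R^-1 : R) <= 8 + 2 * ln (ln N%:R).
Proof.
move=> uP pP sP N0 lN1; rewrite (bigID (fun p => p <= N)%N)/=.
have small : \sum_(p <- P | (p <= N)%N) (p%:R^-1 : R) <= 7 + 2 * ln (ln N%:R).
  apply: le_trans (sum_prime_inv_le N0 lN1).
  rewrite -big_filter -[leRHS]big_filter ler_sum_uniq_sub ?filter_uniq// => p.
  by rewrite !mem_filter mem_index_iota ltnS => /andP[-> /(allP pP)->].
have large : \sum_(p <- P | ~~ (p <= N)%N) (p%:R^-1 : R) <= 1.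
  have NR : (0 : R) < N%:R by rewrite ltr0n.
  apply: le_trans (_ : \sum_(p <- P) (N%:R^-1 : R) <= _).
    rewrite big_mkcond/= ler_sum// => p _; case: ifPn => [|_]; last by rewrite invr_ge0.
    rewrite -ltnNge => Np; rewrite lef_pV2 ?posrE ?ltr0n ?ler_nat ?(ltnW Np)//.
    exact: leq_ltn_trans Np.
  by rewrite big_const_seq count_predT iter_addr_0 -[_ *+ size P]mulr_natl ler_pdivrMr// mul1r ler_nat.
lra.
Qed.

End PrimeSums.

(** * The upper bound *)

Section UpperBound.
Variable R : realType.

Lemma eventually_le_ln (x : R) : exists N0 : nat, forall N : nat, (N0 <= N)%N ->
  (0 < N)%N /\ x <= ln N%:R.
Proof.
exists (Num.bound (expR x)) => N N0.
have H : expR x < N%:R.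
  by apply: lt_le_trans (archi_boundP (expR_ge0 x)) _; rewrite ler_nat.
have NR : (0 : R) < N%:R by exact: lt_trans (expR_gt0 x) H.
split; first by rewrite ltr0n in NR.
by rewrite -ler_expR lnK ?posrE// ltW.
Qed.

Lemma prod_1D_le_expR (I : Type) (s : seq I) (F : I -> R) : (forall i, 0 <= F i) ->
  \prod_(i <- s) (1 + F i) <= expR (\sum_(i <- s) F i).
Proof.
move=> F0; elim: s => [|i s IH]; first by rewrite !big_nil expR0.
rewrite !big_cons expRD ler_pM ?expR_ge1Dx ?addr_ge0// prodr_ge0// => j _.
by rewrite addr_ge0.
Qed.

Lemma gcd_sum_upper_bound (alpha : R) : 0 < alpha -> alpha < 1 / 2 ->
  exists2 b : R, 0 < b & exists N0 : nat, forall N : nat, (N0 <= N)%N ->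
  forall M : seq nat, uniq M -> all (fun m => 0 < m)%N M -> size M = N ->
  N%:R^-1 * gcd_sum alpha M <= N%:R `^ (1 - 2 * alpha) * ln (N%:R : R) `^ b.
Proof.
move=> a0 a1; have [C C0 HC] := valuation_kernel_sum_le a0 a1.
(* The local factors multiply to at most exp (C (8 + 2 ln ln N)) = e^(8C) (ln N)^(2C); the extra 1
   absorbs e^(8C) once ln N >= e^(8C), which fixes [N0]. *)
exists (2 * C + 1); first lra.
have [N0 HN0] := eventually_le_ln (expR (8 * C)).
exists N0 => N /HN0[Npos lN] M uM M0 sM.
have [P [uP pP sP sepP]] := exists_separating_primes uM M0.
have NR : (0 : R) < N%:R by rewrite ltr0n.
have lN1 : 1 <= ln (N%:R : R).
  by apply: le_trans lN; rewrite -expR0 ler_expR mulr_ge0 ?ltW.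
have lN0 : 0 < ln (N%:R : R) by lra.
have llN : 8 * C <= ln (ln (N%:R : R)).
  by rewrite -ler_expR [leRHS]lnK ?posrE.
have sumP : \sum_(p <- P) (p%:R^-1 : R) <= 8 + 2 * ln (ln N%:R).
  by apply: sum_inv_primes_le => //; rewrite -sM.
have prodP : \prod_(p <- P) (1 + C / p%:R) <= ln (N%:R : R) `^ (2 * C + 1).
  apply: le_trans (prod_1D_le_expR _ _) _ => [p|]; first by rewrite divr_ge0 ?(ltW C0).
  rewrite -mulr_sumr /powR (gt_eqF lN0) ler_expR.
  by have := ler_wpM2l (ltW C0) sumP; lra.
have gs : gcd_sum alpha M <= ln (N%:R : R) `^ (2 * C + 1) * (N%:R * N%:R) `^ (1 - alpha).
  apply: le_trans (_ : \sum_(m <- M) \sum_(n <- M) valuation_kernel alpha P m n <= _).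
    rewrite /gcd_sum big_seq [leRHS]big_seq; apply: ler_sum => m mM.
    rewrite big_seq [leRHS]big_seq; apply: ler_sum => n nM.
    by apply: gcd_term_le_valuation_kernel => //; exact: (allP M0).
  apply: le_trans (HC P pP M M uM uM sepP sepP) _.
  by rewrite sM ler_wpM2r ?powR_ge0.
have := ler_wpM2l (ltW (_ : 0 < N%:R^-1)) gs; rewrite invr_gt0 => /(_ NR) H.
apply: le_trans H _; rewrite mulrCA mulrC ler_wpM2r ?powR_ge0//.
rewrite powRM ?ler0n// -powR_inv1 ?ler0n//.
have nz x : x ==> (N%:R != 0 :> R) by rewrite (gt_eqF NR) implybT.
rewrite -!powRD ?nz//; have -> // : -1 + (1 - alpha + (1 - alpha)) = 1 - 2 * alpha by ring.
Qed.

End UpperBound.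

(** * Counting coprime pairs with bounded product *)

(** Each multiple of [d] up to [K] is some d a with a <= K; the right side may carry further
    terms. *)
Lemma sum_multiples_le (F : nat -> nat) d K : (0 < d)%N ->
  (\sum_(a <- iota 1 K | d %| a) F a <= \sum_(a <- iota 1 K) F (d * a))%N.
Proof.
move=> d0; rewrite -big_filter -(big_map (muln d) xpredT F).
apply: (uniq_sub_le_big (le := leq)) => //; first by move=> *; exact: leq_addr.
- by rewrite filter_uniq ?iota_uniq.
- rewrite map_inj_uniq ?iota_uniq// => x y /eqP.
  by rewrite eqn_pmul2l// => /eqP.
move=> a; rewrite mem_filter mem_iota => /andP[/dvdnP[k ->] /andP[a1 aK]].
by rewrite mulnC map_f// mem_iota; nia.
Qed.

Lemma count_multiples a K : (0 < a)%N ->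
  (\sum_(b <- iota 1 K) (a * b <= K) = K %/ a)%N.
Proof.
move=> a0; under eq_bigr => b _ do rewrite mulnC -leq_divRL//.
have qK : (K %/ a <= K)%N by exact: leq_div.
move: (K %/ a)%N qK => q qK; rewrite -{1}(subnKC qK) iotaD big_cat/=.
rewrite [X in (_ + X)%N]big1_seq => [|b /=]; last by rewrite mem_iota; lia.
rewrite addn0 -[RHS](size_iota 1) -sum1_size.
by apply: eq_big_seq => b; rewrite mem_iota => H; lia.
Qed.

Definition coprime_pairs (K : nat) : seq (nat * nat) :=
  [seq ab <- [seq (a, b) | a <- iota 1 K, b <- iota 1 K]
    | coprime ab.1 ab.2 && (ab.1 * ab.2 <= K)%N].

Lemma size_coprime_pairs K : size (coprime_pairs K) =
  (\sum_(a <- iota 1 K) \sum_(b <- iota 1 K) (coprime a b && (a * b <= K)))%N.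
Proof.
rewrite size_filter -sum1_count big_mkcond big_allpairs/=.
by apply: eq_bigr => a _; apply: eq_bigr => b _; case: ifP.
Qed.

(* A non-coprime pair is [d] times another pair, with [d >= 2], whose product
   is at most [K / d ^ 2]. *)
Lemma divisor_sum_le_coprime_pairs K :
  (\sum_(a <- iota 1 K) K %/ a <= size (coprime_pairs K) +
   \sum_(2 <= d < K.+1) (\sum_(a <- iota 1 K) K %/ a) %/ d ^ 2)%N.
Proof.
set D := (\sum_(a <- iota 1 K) K %/ a)%N.
(* [D] counts all pairs with product at most [K], and [E d] those with both entries divisible by
   [d]; a non-coprime pair is counted in [E] at its gcd. *)
pose E d := (\sum_(a <- iota 1 K) \sum_(b <- iota 1 K)
  [&& d %| a, d %| b & a * b <= K])%N.
have DE : D = (\sum_(a <- iota 1 K) \sum_(b <- iota 1 K) (a * b <= K))%N.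
  by apply: eq_big_seq => a; rewrite mem_iota => /andP[a0 _]; rewrite count_multiples.
apply: leq_trans (_ : size (coprime_pairs K) + \sum_(2 <= d < K.+1) E d <= _)%N.
  rewrite DE size_coprime_pairs /E [X in (_ <= _ + X)%N]exchange_big -big_split/=.
  rewrite big_seq [leqRHS]big_seq; apply: leq_sum => a; rewrite mem_iota => aK.
  rewrite [X in (_ <= _ + X)%N]exchange_big -big_split/=.
  rewrite big_seq [leqRHS]big_seq; apply: leq_sum => b; rewrite mem_iota => bK.
  case: (leqP (a * b) K) => // abK; rewrite andbT.
  have [//|nco] := boolP (coprime a b); rewrite add0n.
  have g0 : (0 < gcdn a b)%N by rewrite gcdn_gt0; case/andP: aK => ->.
  have ga : (gcdn a b <= a)%N by rewrite dvdn_leq ?dvdn_gcdl//; case/andP: aK.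
  have g2 : (2 <= gcdn a b < K.+1)%N by move: nco; rewrite /coprime; lia.
  by rewrite (bigD1_seq (gcdn a b)) ?iota_uniq ?mem_index_iota//= dvdn_gcdl dvdn_gcdr.
rewrite leq_add2l big_nat [leqRHS]big_nat; apply: leq_sum => d /andP[d2 _].
have d0 : (0 < d)%N by exact: ltnW.
rewrite leq_divRL ?expn_gt0 ?d0//.
have -> : E d = (\sum_(a <- iota 1 K | d %| a) \sum_(b <- iota 1 K | d %| b) (a * b <= K))%N.
  rewrite [RHS]big_mkcond; apply: eq_bigr => a _; case: ifP => da; last by rewrite big1.
  by rewrite [RHS]big_mkcond; apply: eq_bigr => b _; case: ifP.
(* Rounding down K / (d^2 a) is rounding down K / a and then dividing by d^2, so multiplying by d^2
   does not exceed K / a rounded down. *)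
apply: leq_trans (_ : (\sum_(a <- iota 1 K) K %/ (d ^ 2 * a)) * d ^ 2 <= _)%N.
  rewrite leq_mul2r; apply/orP; right.
  apply: leq_trans (sum_multiples_le _ _ d0) _.
  rewrite big_seq [leqRHS]big_seq; apply: leq_sum => a; rewrite mem_iota => /andP[a0 _].
  apply: leq_trans (sum_multiples_le _ _ d0) _.
  rewrite -count_multiples ?muln_gt0 ?expn_gt0 ?d0//.
  by apply: leq_sum => b _; rewrite (_ : d * a * (d * b) = d ^ 2 * a * b)%N//; ring.
rewrite big_distrl/=; apply: leq_sum => a _.
by rewrite [(d ^ 2 * a)%N]mulnC divnMA leq_trunc_div.
Qed.

(** * Reduced fractions as distinct integers *)

(** Uniqueness of lowest terms: by Gauss's lemma [a] and [c] divide each other. *)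
Lemma eq_pair_of_cross_mul a b c d : (0 < a)%N -> coprime a b -> coprime c d ->
  (a * d = c * b)%N -> (a, b) = (c, d).
Proof.
move=> a0 ab cd E.
have ac : (a %| c)%N by rewrite -(Gauss_dvdl _ ab) -E dvdn_mulr.
have ca : (c %| a)%N by rewrite -(Gauss_dvdl _ cd) E dvdn_mulr.
have eac : a = c by apply/eqP; rewrite eqn_dvd ac.
by move/eqP: E; rewrite -eac eqn_pmul2l// => /eqP ->.
Qed.

(* The fraction [ab.1 / ab.2], scaled by [K`!] to make it an integer. *)
Definition pair_point (K : nat) (ab : nat * nat) : nat := (K`! %/ ab.2 * ab.1)%N.

Lemma mem_coprime_pairs K ab : ab \in coprime_pairs K ->
  [/\ coprime ab.1 ab.2, (ab.1 * ab.2 <= K)%N, (0 < ab.1)%N, (0 < ab.2)%N &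
      (pair_point K ab * ab.2 = K`! * ab.1)%N].
Proof.
rewrite mem_filter => /andP[/andP[co le] /allpairsP[[a b]/= [aK bK E]]].
move: co le; rewrite E/= => co le; move: aK bK; rewrite !mem_iota => aK bK.
split=> //; [by case/andP: aK|by case/andP: bK|].
by rewrite /pair_point/= mulnAC divnK// dvdn_fact// -ltnS -add1n.
Qed.

Lemma pair_point_gt0 K ab : ab \in coprime_pairs K -> (0 < pair_point K ab)%N.
Proof.
case/mem_coprime_pairs=> _ _ a0 _ E.
have : (0 < pair_point K ab * ab.2)%N by rewrite E muln_gt0 fact_gt0.
by rewrite muln_gt0 => /andP[].
Qed.

Lemma pair_point_inj K : {in coprime_pairs K &, injective (pair_point K)}.
Proof.
move=> [a b] [c d] /mem_coprime_pairs[/= co1 _ a0 b0 E1].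
move=> /mem_coprime_pairs[/= co2 _ c0 d0 E2] E.
apply: eq_pair_of_cross_mul => //; apply/eqP.
rewrite -(eqn_pmul2l (fact_gt0 K)) !mulnA -E1 -E2 E; apply/eqP; ring.
Qed.

(** For the fractions a/b and c/d, with g the gcd of the points m and n, the reduced form of ad /
    (bc) is (m/g) / (n/g). Hence mn / g^2 <= (ab) (cd) <= K^2. *)
Lemma pair_point_mul_le K x y : x \in coprime_pairs K -> y \in coprime_pairs K ->
  (pair_point K x * pair_point K y <= gcdn (pair_point K x) (pair_point K y) ^ 2 * K ^ 2)%N.
Proof.
case: x y => [a b] [c d] xK; have /mem_coprime_pairs[/= _ abK a0 b0 E1] := xK.
move=> /mem_coprime_pairs[/= _ cdK c0 d0 E2].
move: E1 E2; set m := pair_point K (a, b); set n := pair_point K (c, d) => E1 E2.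
have m0 : (0 < m)%N by exact: pair_point_gt0 xK.
set g := gcdn m n; have g0 : (0 < g)%N by rewrite gcdn_gt0 m0.
have mE : (m = m %/ g * g)%N by rewrite divnK// dvdn_gcdl.
have nE : (n = n %/ g * g)%N by rewrite divnK// dvdn_gcdr.
have co : coprime (m %/ g) (n %/ g).
  by rewrite /coprime -(eqn_pmul2r g0) mul1n muln_gcdl -mE -nE.
have E : (m %/ g * (b * c) = n %/ g * (a * d))%N.
  apply/eqP; rewrite -(eqn_pmul2r g0); apply/eqP.
  transitivity (m * b * c)%N; first by rewrite {2}mE; ring.
  transitivity (n * d * a)%N; last by rewrite {1}nE; ring.
  by rewrite E1 E2; ring.
have lem : (m %/ g <= a * d)%N.
  by rewrite dvdn_leq ?muln_gt0 ?a0// -(Gauss_dvdr _ co) -E dvdn_mulr.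
have len : (n %/ g <= b * c)%N.
  rewrite dvdn_leq ?muln_gt0 ?b0// -(@Gauss_dvdr _ (m %/ g)) 1?coprime_sym//.
  by rewrite E dvdn_mulr.
rewrite mE nE (_ : _ * g * _ = g ^ 2 * (m %/ g * (n %/ g)))%N; last by ring.
rewrite leq_mul2l; apply/orP; right.
apply: leq_trans (leq_mul lem len) _.
rewrite (_ : a * d * (b * c) = (a * b) * (c * d))%N; last by ring.
by rewrite expnS expn1 leq_mul.
Qed.

(** * The lower bound *)

Section LowerBound.
Variable R : realType.

(** The term 1/4 is kept exact, and 1/d^2 <= 1/(d-1) - 1/d telescopes to at most 1/2 from d = 3 on.
    Telescoping from d = 2 would give only 1, too weak for counting coprime pairs. *)
Lemma sum_inv_squares_le K :
  \sum_(2 <= d < K.+1) ((d ^ 2)%N%:R^-1 : R) <= 3 / 4.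
Proof.
suff H n : \sum_(2 <= d < n.+3) ((d ^ 2)%N%:R^-1 : R) <= 3 / 4 - n.+2%:R^-1.
  case: K => [|[|n]]; try by rewrite big_geq//; lra.
  by apply: le_trans (H n) _; rewrite lerBlDr lerDl invr_ge0.
elim: n => [|n IH]; first by rewrite big_nat1; lra.
rewrite big_nat_recr//=; apply: le_trans (lerD IH (lexx _)) _.
set k : R := n.+2%:R; have k0 : 0 < k by rewrite ltr0n.
have -> : ((n.+3 ^ 2)%N%:R : R) = (k + 1) ^+ 2 by rewrite natrX /k natr1.
have -> : (n.+3%:R : R) = k + 1 by rewrite /k natr1.
clearbody k => {IH}.
suff : ((k + 1) ^+ 2)^-1 <= k^-1 - (k + 1)^-1.
  by move: (_^-1) (_^-1) (_^-1) => x y z; lra.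
have -> : k^-1 - (k + 1)^-1 = (k * (k + 1))^-1.
  by field; rewrite !gt_eqF//; lra.
by rewrite lef_pV2 ?posrE ?exprn_gt0 ?mulr_gt0//; nra.
Qed.

(** For a <= K, rounding down K / a loses at most half of it. *)
Lemma divisor_sum_ge K :
  K%:R * ln (K.+1%:R : R) / 2 <= (\sum_(a <- iota 1 K) K %/ a)%N%:R.
Proof.
have H := @harmonic_ge_ln R K.
apply: le_trans (_ : K%:R * (\sum_(1 <= j < K.+1) j%:R^-1) / 2 <= _).
  by rewrite ler_wpM2r ?invr_ge0// ler_wpM2l.
rewrite mulr_sumr mulr_suml natr_sum /index_iota subn1/=.
rewrite big_seq [leRHS]big_seq; apply: ler_sum => a; rewrite mem_iota => /andP[a1 aK].
have a0 : (0 : R) < a%:R by rewrite ltr0n.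
rewrite ler_pdivrMr// ler_pdivrMr// -!natrM ler_nat.
have := divn_eq K a; have := ltn_pmod K a1.
have : (0 < K %/ a)%N by rewrite divn_gt0//; lia.
move: (K %/ a)%N (K %% a)%N => q s; nia.
Qed.

(** Non-coprime pairs take at most 3/4 of the divisor sum, leaving a quarter of it. *)
Lemma size_coprime_pairs_ge K :
  K%:R * ln (K.+1%:R : R) / 8 <= (size (coprime_pairs K))%:R.
Proof.
have := divisor_sum_le_coprime_pairs K; have := divisor_sum_ge K.
set D := (\sum_(a <- iota 1 K) K %/ a)%N => HD.
rewrite -(@ler_nat R) natrD natr_sum => HT.
have S : \sum_(2 <= d < K.+1) ((D %/ d ^ 2)%N%:R : R) <= D%:R * (3 / 4).
  apply: le_trans (ler_wpM2l (ler0n _ D) (sum_inv_squares_le K)).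
  rewrite mulr_sumr; apply: ler_sum_nat => d /andP[d2 _].
  have d0 : (0 < d ^ 2)%N by rewrite expn_gt0 ltnW.
  by rewrite ler_pdivlMr ?ltr0n// -natrM ler_nat leq_trunc_div.
move: (K%:R * _) HD => t; lra.
Qed.

Lemma exists_set_gcd_sum_ge (alpha : R) (K N : nat) : 0 < alpha -> (0 < K)%N ->
  (N <= size (coprime_pairs K))%N ->
  exists M : seq nat, [/\ uniq M, all (fun m => 0 < m)%N M, size M = N &
    N%:R * N%:R / (K%:R `^ (2 * alpha)) <= gcd_sum alpha M].
Proof.
move=> a0 K0 NK; exists (take N (map (pair_point K) (coprime_pairs K))).
have upairs : uniq (coprime_pairs K).
  by rewrite filter_uniq// allpairs_uniq ?iota_uniq// => -[? ?] [? ?].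
have sM : size (take N (map (pair_point K) (coprime_pairs K))) = N.
  by rewrite size_takel// size_map.
have memM m : m \in take N (map (pair_point K) (coprime_pairs K)) ->
    exists2 x, x \in coprime_pairs K & m = pair_point K x.
  by move/mem_take/mapP.
have posM m : m \in take N (map (pair_point K) (coprime_pairs K)) -> (0 < m)%N.
  by case/memM => x xK ->; exact: pair_point_gt0.
split=> //.
- by rewrite take_uniq// map_inj_in_uniq//; exact: pair_point_inj.
- exact/allP.
rewrite /gcd_sum; move: sM memM posM; set M := take _ _ => sM memM posM.
have KR : (0 : R) < K%:R by rewrite ltr0n.
apply: le_trans (_ : \sum_(m <- M) \sum_(n <- M) (K%:R `^ (2 * alpha))^-1 <= _).
  rewrite !(big_const_seq, count_predT, iter_addr_0) sM.
  by rewrite -[_ *+ N *+ N]mulr_natl -[_^-1 *+ N]mulr_natl mulrA.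
rewrite big_seq [leRHS]big_seq; apply: ler_sum => m mM.
rewrite big_seq [leRHS]big_seq; apply: ler_sum => n nM.
have m0 := posM m mM; have n0 := posM n nM.
have [x xP mE] := memM m mM; have [y yP nE] := memM n nM.
have mnK : (m * n <= gcdn m n ^ 2 * K ^ 2)%N by rewrite mE nE; exact: pair_point_mul_le.
rewrite ler_pdivlMr; last by rewrite powR_gt0// ltr0n muln_gt0 m0.
rewrite mulrC ler_pdivrMr ?powR_gt0// !powRrM.
rewrite !powR_mulrn ?ler0n// -powRM ?exprn_ge0 ?ler0n//.
by rewrite ge0_ler_powR ?nnegrE ?mulr_ge0 ?exprn_ge0 ?(ltW a0)// -!natrX -natrM ler_nat.
Qed.

Lemma gcd_sum_lower_bound (alpha : R) : 0 < alpha ->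
  exists N0 : nat, forall N : nat, (N0 <= N)%N ->
  exists M : seq nat, [/\ uniq M, all (fun m => 0 < m)%N M, size M = N &
  N%:R `^ (1 - 2 * alpha) * ln (N%:R : R) `^ alpha <= N%:R^-1 * gcd_sum alpha M].
Proof.
(* 289 = 17^2, the square of the constant in [K17]. *)
move=> a0; have [N0 HN0] := eventually_le_ln (289 : R).
exists N0 => N /HN0[Npos lN].
have NR : (0 : R) < N%:R by rewrite ltr0n.
set l := ln (N%:R : R) in lN *; have l0 : 0 < l by lra.
(* Since ln x >= l / 2, the count K ln (K+1) / 8 is at least x (l / 2) / 8 = N. *)
set x := 16 * N%:R / l; have x0 : 0 < x by rewrite divr_gt0 ?mulr_gt0.
pose K := (Num.truncn x).+1.
have /andP[Kx xK] := Num.Theory.truncn_itv (ltW x0).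
have lx : l / 2 <= ln x.
  have e1 : ln x = ln 16 + l - ln l by rewrite ln_div ?posrE ?mulr_gt0// lnM ?posrE.
  have e2 : 0 <= ln (16 : R) by rewrite ln_ge0// ler1n.
  have e3 : ln l <= l / 2.
    have -> : l = 2 * (l / 2) by field.
    rewrite lnM ?posrE ?divr_gt0// [2 * (l / 2)]mulrC mulfK//.
    have := @le_ln1Dx R 1; have -> : 1 + 1 = 2 :> R by lra.
    have := @le_ln1Dx R (l / 2 - 1); have -> : 1 + (l / 2 - 1) = l / 2 by lra.
    lra.
  lra.
have sizeK : (N <= size (coprime_pairs K))%N.
  rewrite -(@ler_nat R); apply: le_trans (size_coprime_pairs_ge K).
  have lK : l / 2 <= ln (K.+1%:R : R).
    apply: le_trans lx _; rewrite ler_ln ?posrE ?ltr0n//.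
    by apply: le_trans (ltW xK) _; rewrite ler_nat.
  have := ler_pM (ltW x0) _ (ltW xK) lK; rewrite divr_ge0 ?(ltW l0)// => /(_ isT).
  have -> : x * (l / 2) = 8 * N%:R by rewrite /x; field; rewrite gt_eqF.
  by rewrite -/K; lra.
have [M [uM M0 sM gM]] := exists_set_gcd_sum_ge a0 (isT : 0 < K)%N sizeK.
exists M; split=> //.
apply: le_trans (ler_wpM2l _ gM); last by rewrite invr_ge0.
have KR : (0 : R) < K%:R by rewrite ltr0n.
have K17 : K%:R * l <= 17 * N%:R.
  have : l <= N%:R by rewrite ltW// ln_sublinear.
  have : K%:R <= x + 1 by rewrite /K -natr1; lra.
  move/(ler_wpM2r (ltW l0)).
  have -> : (x + 1) * l = 16 * N%:R + l by rewrite /x; field; rewrite gt_eqF.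
  lra.
(* In (K l)^2 <= 289 N^2 one factor l pays for 289; the other survives and yields the power alpha of
   ln N. *)
have KN : l * K%:R ^+ 2 <= N%:R ^+ 2.
  have Kl0 : 0 <= K%:R * l by rewrite mulr_ge0 ?ltW.
  have : (K%:R * l) ^+ 2 <= (17 * N%:R) ^+ 2 by apply: lerXn2r; rewrite ?nnegrE ?Kl0// mulr_ge0.
  rewrite !exprMn => H.
  rewrite -(ler_pM2l l0); apply: le_trans (_ : 289 * N%:R ^+ 2 <= _).
    rewrite mulrA -expr2 mulrC; apply: le_trans H _.
    by rewrite le_eqVlt; apply/orP; left; apply/eqP; ring.
  by rewrite ler_wpM2r ?exprn_ge0 ?ler0n.
have KNa : l `^ alpha * K%:R `^ (2 * alpha) <= N%:R `^ (2 * alpha).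
  rewrite !powRrM !powR_mulrn ?ler0n// -powRM ?exprn_ge0 ?ler0n ?(ltW l0)//.
  by rewrite ge0_ler_powR ?nnegrE ?mulr_ge0 ?exprn_ge0 ?ler0n ?(ltW l0) ?(ltW a0).
have nz y : y ==> (N%:R != 0 :> R) by rewrite (gt_eqF NR) implybT.
rewrite powRB ?nz// powRr1 ?ler0n//.
have -> : N%:R^-1 * (N%:R * N%:R / K%:R `^ (2 * alpha)) = N%:R / K%:R `^ (2 * alpha).
  by field; rewrite !gt_eqF ?powR_gt0.
rewrite -!mulrA ler_wpM2l ?ler0n// mulrC.
by rewrite ler_pdivrMr ?powR_gt0// mulrC ler_pdivlMr ?powR_gt0.
Qed.

End LowerBound.

(** * Both bounds for the supremum *)

Unset Implicit Arguments.

Theorem theorem1 (R : realType) (alpha : R) :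
  0 < alpha -> alpha < 1 / 2 ->
  exists a b : R, [/\ 0 < a, 0 < b &
    exists N0 : nat, forall N : nat, (N0 <= N)%N ->
      N%:R `^ (1 - 2 * alpha) * (ln (N%:R : R)) `^ a <= Gamma alpha N /\
      Gamma alpha N <= N%:R `^ (1 - 2 * alpha) * (ln (N%:R : R)) `^ b].
Proof.
move=> a0 a1; have [b b0 [N1 upper]] := gcd_sum_upper_bound a0 a1.
have [N2 lower] := gcd_sum_lower_bound a0.
exists alpha, b; split=> //; exists (maxn N1 N2) => N.
rewrite geq_max => /andP[/upper {}upper /lower[M [uM M0 sM gM]]].
(* The uniform upper bound also makes the set of values bounded above, which the lower estimate on
   [sup] requires; [mem] supplies nonemptiness. *)
have ub : ubound (Gamma_values alpha N)
    (N%:R `^ (1 - 2 * alpha) * (ln (N%:R : R)) `^ b).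
  by move=> x [M' [uM' M0' sM' ->]]; exact: upper.
have mem : Gamma_values alpha N (N%:R^-1 * gcd_sum alpha M) by exists M.
split; last by apply: ge_sup => //; exists (N%:R^-1 * gcd_sum alpha M).
apply: le_trans gM _; apply: ub_le_sup => //.
by exists (N%:R `^ (1 - 2 * alpha) * (ln (N%:R : R)) `^ b).
Qed.
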